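(* Let $r$ be a fixed positive integer and let $\epsilon>0$ be a constant. Then there is $n_0=n_0(r,\epsilon)$ such that for all $n\ge n_0$ the following holds: if $\mathcal{H}$ is an $r$-uniform $r$-partite linear hypergraph on $n$ vertices with at least $\epsilon n^2$ edges, then $\mathcal{H}$ contains a rainbow $k$-cycle for every integer $k$ with $3\le k\le r$.
   Context: A hypergraph is a finite vertex set together with a collection of subsets (edges). It is $r$-uniform if every edge has exactly $r$ vertices, and linear if any two distinct edges share at most one vertex. An $r$-uniform hypergraph is $r$-partite if its vertex set is a disjoint union $V_1\cup\cdots\cup V_r$ (the vertex parts) such that every edge meets each $V_i$ in exactly one vertex. For an $r$-uniform $r$-partite linear hypergraph with vertex parts $V_1,\ldots,V_r$, a rainbow $k$-cycle is an alternating sequence $v_1,E_1,v_2,E_2,\ldots,v_k,E_k,v_1$ such that: (a) $v_1,\ldots,v_k$ are distinct vertices; (b) $E_1,\ldots,E_k$ are distinct edges; (c) $v_i,v_{i+1}\in E_i$ for $1\le i\le k-1$ and $v_k,v_1\in E_k$; (d) $v_i\in V_{j_i}$ for $1\le i\le k$, where $j_1,\ldots,j_k$ are pairwise distinct. *)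

(* Defs.v *)
From mathcomp Require Import all_boot.

Set Implicit Arguments.
Unset Strict Implicit.
Unset Printing Implicit Defensive.

(* A hypergraph on the finite vertex type T is given by its set of edges
   H : {set {set T}}. *)

Definition uniform (r : nat) (T : finType) (H : {set {set T}}) : Prop :=
  forall E : {set T}, E \in H -> #|E| = r.

Definition linear_hypergraph (T : finType) (H : {set {set T}}) : Prop :=
  forall E F : {set T}, E \in H -> F \in H -> E != F -> #|E :&: F| <= 1.

(* Parts are not required to be nonempty; they automatically are as soon as
   H has an edge. *)
Definition vertex_parts (r : nat) (T : finType) (V : 'I_r -> {set T})
    (H : {set {set T}}) : Prop :=
  [/\ \bigcup_(i < r) V i = [set: T],
      forall i j : 'I_r, i != j -> [disjoint V i & V j]
    & forall (E : {set T}) (i : 'I_r), E \in H -> #|E :&: V i| = 1].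

(* Indices run over 'I_k = {0, ..., k-1}, and [ordS] is the cyclic successor,
   so that the last edge joins the last vertex to the first one. *)
Definition rainbow_cycle (r k : nat) (T : finType) (V : 'I_r -> {set T})
    (H : {set {set T}}) (v : 'I_k -> T) (E : 'I_k -> {set T}) : Prop :=
  [/\ injective v,
      injective E /\ (forall i : 'I_k, E i \in H),
      forall i : 'I_k, v i \in E i /\ v (ordS i) \in E i
    & exists2 j : 'I_k -> 'I_r, injective j & forall i : 'I_k, v i \in V (j i)].

Definition has_rainbow_cycle (r k : nat) (T : finType) (V : 'I_r -> {set T})
    (H : {set {set T}}) : Prop :=
  exists (v : 'I_k -> T) (E : 'I_k -> {set T}), rainbow_cycle V H v E.

(* Main.v *)
(* Let x_0, ..., x_{k-1} be the coordinates of an edge in k of the parts.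
   Suppose that every edge e carries a pair (x_{k-1} e, x_0 e) with linearly many
   common neighbours in the next part.  Then a rainbow k-cycle extends to a
   rainbow (k+1)-cycle: replace its closing edge by a path of length two through
   a common neighbour outside the k vertices that the edges of the cycle have in
   the next part; by linearity the two new edges are new and distinct.  A single
   edge, seen as a degenerate 2-cycle, starts the induction.

   It remains to discard the "poor" edges, those whose pair (be e, ga e) has
   fewer than delta n common neighbours a.  There are at most eps n^2 of them,
   by the Ruzsa-Szemeredi argument: take a regular partition (found by energy
   increment) for the single bipartite graph of the pairs (be e, ga e) of poor
   edges e.  After discarding the poor edges that lie in bad pairs of classes,
   or whose be- or ga-end lies in a class which the be- or ga-neighbourhood of
   al e hardly meets, each surviving edge e gives its vertex al e quadratically
   many triangles; since poor pairs lie in few triangles, few al e survive. *)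
Require Import Defs.
From mathcomp Require Import all_boot all_order all_algebra.
From mathcomp Require Import reals.
From mathcomp Require Import ring lra zify.
Import Order.TTheory GRing.Theory Num.Theory.
Local Open Scope ring_scope.

Set Implicit Arguments.
Unset Strict Implicit.
Unset Printing Implicit Defensive.

(** * One-sided regularity of bipartite graphs *)

Section Energy.

Variables (R : realFieldType) (I : finType) (f : I -> R).

Definition mean (C : finType) (c : I -> C) (k : C) : R :=
  (\sum_(u | c u == k) f u) / #|[pred u | c u == k]|%:R.

(** The squared norm of the conditional expectation of [f] given [c]; summing over points weights
    each class by its size. *)
Definition energy (C : finType) (c : I -> C) : R := \sum_u mean c (c u) ^+ 2.

Lemma sum_fiber_mean (C : finType) (c : I -> C) (k : C) :
  \sum_(u | c u == k) f u = #|[pred u | c u == k]|%:R * mean c k.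
Proof.
rewrite /mean mulrCA; case: (posnP #|[pred u | c u == k]|) => [k0|kgt0].
  rewrite k0 mul0r mulr0 big_pred0 // => u.
  by have := card0_eq k0 u; rewrite inE.
by rewrite divff ?mulr1 // pnatr_eq0 -lt0n.
Qed.

(** Averaging over the classes is an orthogonal projection: against functions of the colour, [f] and
    its class means have the same sum. *)
Lemma sum_mean_mul (C : finType) (c : I -> C) (h : C -> R) :
  \sum_u mean c (c u) * h (c u) = \sum_u f u * h (c u).
Proof.
rewrite (partition_big c xpredT) //= [RHS](partition_big c xpredT) //=.
apply: eq_bigr => k _.
rewrite (eq_bigr (fun=> mean c k * h k)) => [|u /eqP-> //].
rewrite [RHS](eq_bigr (fun u => f u * h k)) => [|u /eqP-> //].
by rewrite -[RHS]mulr_suml sum_fiber_mean sumr_const -[in LHS]mulr_natl mulrA.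
Qed.

Lemma energy_le (C : finType) (c : I -> C) : energy c <= \sum_u f u ^+ 2.
Proof.
have /eqP : energy c - \sum_u f u * mean c (c u) = 0.
  by rewrite -sum_mean_mul subrr.
have : 0 <= \sum_u (f u - mean c (c u)) ^+ 2.
  by apply: sumr_ge0 => u _; exact: sqr_ge0.
have -> : \sum_u (f u - mean c (c u)) ^+ 2 =
   \sum_u f u ^+ 2 - 2 * (\sum_u f u * mean c (c u)) + energy c.
  rewrite /energy mulr_sumr -sumrB -big_split /=.
  by apply: eq_bigr => u _; ring.
by move=> ? /eqP ?; lra.
Qed.

Lemma energy_ge0 (C : finType) (c : I -> C) : 0 <= energy c.
Proof. by apply: sumr_ge0 => u _; exact: sqr_ge0. Qed.

(* Pythagoras: [energy d - energy c] is the sum of the [(mean d - mean c) ^+ 2],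
   and [z ^+ 2 >= - 2 * eta * z - eta ^+ 2] is used where [W] holds. *)
Lemma energy_refine (C D : finType) (c : I -> C) (d : I -> D) (phi : D -> C)
    (W : pred D) (eta : R) :
    (forall u, c u = phi (d u)) -> 0 <= eta ->
    \sum_(u | W (d u)) (f u - mean c (c u)) <= - (eta *+ #|[pred u | W (d u)]|) ->
  energy c + eta ^+ 2 *+ #|[pred u | W (d u)]| <= energy d.
Proof.
move=> cE eta0; set w := fun k => (W k)%:R : R.
have -> : eta *+ #|[pred u | W (d u)]| = eta * \sum_u w (d u).
  by rewrite -sumr_const mulr_sumr big_mkcond /=; apply: eq_bigr => u _;
    rewrite inE /w; case: ifP; rewrite ?mulr1 ?mulr0.
have -> : eta ^+ 2 *+ #|[pred u | W (d u)]| = eta ^+ 2 * \sum_u w (d u).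
  by rewrite -sumr_const mulr_sumr big_mkcond /=; apply: eq_bigr => u _;
    rewrite inE /w; case: ifP; rewrite ?mulr1 ?mulr0.
have -> : \sum_(u | W (d u)) (f u - mean c (c u)) =
    \sum_u f u * w (d u) - \sum_u mean c (c u) * w (d u).
  rewrite -sumrB big_mkcond /=; apply: eq_bigr => u _.
  by rewrite /w; case: ifP => _; rewrite ?mulr1 // !mulr0 subrr.
have Ew := sum_mean_mul d w.
(* As [c] factors through [d], the coarse means are functions of the fine colour, so the fine means
   may be replaced by [f] and then by the coarse means. *)
have Ed : \sum_u mean d (d u) * mean c (c u) = energy c.
  transitivity (\sum_u mean d (d u) * (mean c \o phi) (d u)).
    by apply: eq_bigr => u _; rewrite cE.
  rewrite sum_mean_mul /energy.
  transitivity (\sum_u f u * mean c (c u)).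
    by apply: eq_bigr => u _; rewrite cE.
  by rewrite -sum_mean_mul; apply: eq_bigr => u _.
have : 0 <= \sum_u ((mean d (d u) - mean c (c u)) ^+ 2 +
    w (d u) * (2 * eta * (mean d (d u) - mean c (c u)) + eta ^+ 2)).
  apply: sumr_ge0 => u _; rewrite /w; case: (W _); last first.
    by rewrite mul0r addr0 sqr_ge0.
  rewrite mul1r (_ : _ + _ = (mean d (d u) - mean c (c u) + eta) ^+ 2) ?sqr_ge0 //.
  by ring.
have -> : \sum_u ((mean d (d u) - mean c (c u)) ^+ 2 +
    w (d u) * (2 * eta * (mean d (d u) - mean c (c u)) + eta ^+ 2)) =
  energy d - 2 * (\sum_u mean d (d u) * mean c (c u)) + energy c +
  2 * eta * (\sum_u mean d (d u) * w (d u) - \sum_u mean c (c u) * w (d u))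
  + eta ^+ 2 * \sum_u w (d u).
  rewrite /energy !mulr_sumr -!sumrB !mulr_sumr -!big_split /=.
  by apply: eq_bigr => u _; ring.
rewrite Ed Ew => h1 h2.
have h3 := ler_wpM2l eta0 h2.
set sw := \sum_u w (d u) in h1 h2 h3 *.
set fw := \sum_u f u * _ in h1 h2 h3 *.
set mw := \sum_u mean c _ * _ in h1 h2 h3 *.
have : eta * (fw - mw) <= - (eta ^+ 2 * sw) by rewrite expr2 -mulrA -mulrN.
lra.
Qed.

End Energy.

(** * Counting by fibres *)

Section Fibers.

Variables (I C : finType) (c : I -> C).

Lemma card_le_sum_fibers (R : numDomainType) (A : {set I}) (t : C -> R) :
    (forall k, #|[set u in A | c u == k]|%:R <= t k) ->
  #|A|%:R <= \sum_k t k.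
Proof.
move=> At; rewrite -sum1_card (partition_big c xpredT) //= natr_sum.
apply: ler_sum => k _; apply: le_trans (At k).
by rewrite -sum1_card ler_nat; apply/eq_leq/eq_bigl => u; rewrite inE.
Qed.

Lemma sum_card_fibers : (\sum_k #|[set u | c u == k]| = #|I|)%N.
Proof.
rewrite -sum1_card (partition_big c xpredT) //=.
by apply: eq_bigr => k _; rewrite -sum1_card; apply: eq_bigl => u; rewrite inE.
Qed.

End Fibers.

(** * Lower regular pairs and the regularity lemma *)

Definition edges_between (T : finType) (G : rel T) (A B : {set T}) : nat :=
  #|[set u in setX A B | G u.1 u.2]|.

(** Only a lower bound on the density between large subsets is asked, not closeness to the density
    of the whole pair. *)
Definition lower_regular (R : realFieldType) (eta : R) (T : finType)
    (G : rel T) (X Y : {set T}) : bool :=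
  [forall A : {set T}, forall B : {set T},
    [&& A \subset X, B \subset Y, eta * #|X|%:R <= #|A|%:R
      & eta * #|Y|%:R <= #|B|%:R] ==>
    (eta * (#|A| * #|B|)%:R <= (edges_between G A B)%:R)].

Definition colour_class (T P : finType) (p : T -> P) (i : P) : {set T} :=
  [set x | p x == i].

Definition pair_colour (T P : finType) (p : T -> P) (u : T * T) : P * P :=
  (p u.1, p u.2).

Section Regularity.

Variables (R : archiRealFieldType) (eta : R).
Hypothesis eta_gt0 : 0 < eta.

Section FixGraph.

Variables (T : finType) (G : rel T).

Let g (u : T * T) : R := (G u.1 u.2)%:R.

Lemma sum_edges (A : pred (T * T)) :
  \sum_(u | A u) g u = #|[set u | A u & G u.1 u.2]|%:R.
Proof.
rewrite -sum1_card natr_sum big_mkcond [RHS]big_mkcond /=.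
by apply: eq_bigr => u _; rewrite inE /g; case: (A u); case: (G _ _).
Qed.

Lemma pair_colour_fiber (P : finType) (p : T -> P) (i j : P) (u : T * T) :
  (pair_colour p u == (i, j)) = (u \in setX (colour_class p i) (colour_class p j)).
Proof. by rewrite !inE xpair_eqE. Qed.

(** The threshold [2 * eta] leaves a gap of [eta] above the density of any irregularity witness;
    sparser pairs carry few edges and are counted in [card_sparse_le]. *)
Definition dense_irregular (P : finType) (p : T -> P) (k : P * P) : bool :=
  let X := colour_class p k.1 in let Y := colour_class p k.2 in
  (2 * eta * (#|X| * #|Y|)%:R <= (edges_between G X Y)%:R) &&
  ~~ lower_regular eta G X Y.

Lemma dense_irregular_witness (P : finType) (p : T -> P) :
  exists XY : P * P -> {set T} * {set T}, forall k, dense_irregular p k ->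
    let X := colour_class p k.1 in let Y := colour_class p k.2 in
    [/\ (XY k).1 \subset X, (XY k).2 \subset Y,
        eta * #|X|%:R <= #|(XY k).1|%:R, eta * #|Y|%:R <= #|(XY k).2|%:R
      & (edges_between G (XY k).1 (XY k).2)%:R
          < eta * (#|(XY k).1| * #|(XY k).2|)%:R].
Proof.
pose bad (k : P * P) (AB : {set T} * {set T}) :=
  let X := colour_class p k.1 in let Y := colour_class p k.2 in
  [&& AB.1 \subset X, AB.2 \subset Y, eta * #|X|%:R <= #|AB.1|%:R,
      eta * #|Y|%:R <= #|AB.2|%:R
    & (edges_between G AB.1 AB.2)%:R < eta * (#|AB.1| * #|AB.2|)%:R].
exists (fun k => odflt (set0, set0) [pick AB | bad k AB]) => k.
case/andP=> _ /forallPn[A /forallPn[B]]; rewrite negb_imply -ltNge.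
case/andP=> /and4P[AX BY lA lB] lAB.
case: pickP => [AB /and5P[] // | /(_ (A, B))].
by rewrite /bad /= AX BY lA lB lAB.
Qed.

(* Splitting every class by all the irregularity witnesses it takes part in. *)
Lemma regularity_increment (P : finType) (p : T -> P) :
  exists (Q : finType) (q : T -> Q),
    (#|Q| <= #|P| * (2 ^ #|P| * 2 ^ #|P|))%N /\
    energy g (pair_colour p)
      + eta ^+ 4 *+ #|[pred u | dense_irregular p (pair_colour p u)]|
      <= energy g (pair_colour q).
Proof.
have [XY XYP] := dense_irregular_witness p.
pose Q := (P * ({set P} * {set P}))%type.
(* The new colour of [x] keeps the old one and records which left witnesses and which right
   witnesses of its class contain [x]. *)
pose q x : Q := (p x, ([set j | x \in (XY (p x, j)).1],
                       [set i | x \in (XY (i, p x)).2])).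
exists Q, q; split.
  by rewrite !card_prod -!cardsT -!powersetT !card_powerset cardsT.
pose phi (k : Q * Q) := (k.1.1, k.2.1).
(* [W] selects the points of the witness rectangles of the dense irregular pairs; it depends on the
   new colours alone. *)
pose W (k : Q * Q) := [&& dense_irregular p (phi k), k.2.1 \in k.1.2.1
                        & k.1.1 \in k.2.2.2].
pose c := pair_colour p.
have WE (u : T * T) : W (pair_colour q u) =
    dense_irregular p (c u) && (u \in setX (XY (c u)).1 (XY (c u)).2).
  by rewrite /W /= !inE.
have fiberW k : dense_irregular p k ->
    forall u, W (pair_colour q u) && (c u == k) =
      (u \in setX (XY k).1 (XY k).2).
  move=> bk u; rewrite WE.
  have [AX BY _ _ _] := XYP k bk.
  apply/idP/idP => [/andP[/andP[_ uW] /eqP ck]|uW]; first by rewrite -ck.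
  have ck : c u = k.
    have /setXP[u1 u2] : (u.1, u.2) \in setX (XY k).1 (XY k).2.
      by rewrite -surjective_pairing.
    move: (subsetP AX _ u1) (subsetP BY _ u2).
    by rewrite !inE => /eqP p1 /eqP p2;
      rewrite /c /pair_colour p1 p2 -surjective_pairing.
  by rewrite ck bk uW eqxx.
(* A witness rectangle has density below [eta] in a pair of mean at least [2 * eta], so [g] falls
   short of the mean by [eta] on average. *)
have sumW : \sum_(u | W (pair_colour q u)) (g u - mean g c (c u))
    <= - (eta *+ #|[pred u | W (pair_colour q u)]|).
  rewrite -subr_le0 opprK -sumr_const -big_split /=.
  rewrite (partition_big c xpredT) //=; apply: sumr_le0 => k _.
  rewrite (eq_bigr (fun u => g u - (mean g c k - eta))); last first.
    by move=> u /andP[_ /eqP ->]; ring.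
  have [bk|bk] := boolP (dense_irregular p k); last first.
    rewrite big_pred0 // => u; rewrite WE.
    by case: eqP => [->|]; rewrite ?andbF // (negPf bk).
  rewrite (eq_bigl _ _ (fiberW k bk)) sumrB sum_edges sumr_const.
  have [AX BY _ _] := XYP k bk; rewrite /edges_between.
  rewrite cardsX -[(_ - eta) *+ _]mulr_natr.
  have [/eqP->|n0] := boolP ((#|(XY k).1| * #|(XY k).2|)%N == 0%N).
    by rewrite !mulr0 subr0 => /ltW.
  move=> lt; rewrite mulrBl opprB.
  set N := (_ * _)%:R in lt *; set e := _%:R in lt *.
  suff : 2 * eta * N <= mean g c k * N by lra.
  apply: ler_wpM2r => //; case/andP: bk => dk _.
  have := sum_fiber_mean g c k; case: k dk AX BY n0 {lt N e} => i j /= dk AX BY n0.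
  rewrite (eq_bigl _ _ (pair_colour_fiber p i j)) sum_edges.
  rewrite (eq_card (pair_colour_fiber p i j)) cardsX => E.
  move: dk; rewrite /edges_between E mulrC ler_pM2l // ltr0n.
  move: n0; rewrite -lt0n !muln_gt0 => /andP[A0 B0].
  by rewrite (leq_trans A0 (subset_leq_card AX)) (leq_trans B0 (subset_leq_card BY)).
(* Both sides of a rectangle fill a proportion [eta] of their class, so it fills [eta ^+ 2] of the
   pair; the energy gain per point of the pair is then [eta ^+ 4]. *)
have cardW : eta ^+ 2 *+ #|[pred u | dense_irregular p (c u)]|
    <= #|[pred u | W (pair_colour q u)]|%:R.
  rewrite -sumr_const -sum1_card natr_sum.
  rewrite (partition_big c xpredT) //= [leRHS](partition_big c xpredT) //=.
  apply: ler_sum => k _.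
  have [bk|bk] := boolP (dense_irregular p k); last first.
    rewrite big_pred0 ?sumr_ge0 // => u; rewrite inE.
    by case: eqP => [->|]; rewrite ?andbF // (negPf bk).
  rewrite [leRHS](eq_bigl _ _ (fiberW k bk)) !sumr_const cardsX.
  have [_ _ lA lB _] := XYP k bk.
  rewrite (_ : #|_| = (#|colour_class p k.1| * #|colour_class p k.2|)%N).
    rewrite -[leLHS]mulr_natr !natrM expr2 mulrACA.
    by apply: ler_pM => //; rewrite mulr_ge0 ?ler0n ?ltW.
  rewrite -cardsX; apply: eq_card => u; rewrite -pair_colour_fiber -surjective_pairing.
  by rewrite unfold_in inE; case: eqP => [->|]; rewrite ?andbF // bk.
have := energy_refine (phi := phi) _ (ltW eta_gt0) sumW.
move=> /(_ (fun=> erefl)); apply: le_trans; rewrite lerD2l.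
rewrite -[leRHS]mulr_natr -mulr_natr.
have e2 : 0 <= eta ^+ 2 by exact: sqr_ge0.
have := ler_wpM2l e2 cardW; rewrite -mulr_natr mulrA -exprD; exact.
Qed.

End FixGraph.

(** Each refinement that starts from more than [eta * #|T|%:R ^+ 2] irregular points gains
    [eta ^+ 5 * #|T|%:R ^+ 2]. The bound [K] depends on [eta] and [m] only. *)
Lemma regularity_or_energy (m : nat) :
  exists K : nat, forall (T : finType) (G : rel T),
    exists (P : finType) (p : T -> P), (#|P| <= K)%N /\
      (#|[pred u | dense_irregular G p (pair_colour p u)]|%:R
         <= eta * #|T|%:R ^+ 2 \/
       eta ^+ 5 * #|T|%:R ^+ 2 *+ m
         <= energy (fun u => (G u.1 u.2)%:R : R) (pair_colour p)).
Proof.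
elim: m => [|m [K IH]].
  exists 1%N => T G; exists unit, (fun=> tt); rewrite card_unit; split=> //.
  by right; rewrite mulr0n energy_ge0.
exists (K * (2 ^ K * 2 ^ K))%N => T G.
have [P [p [PK h]]] := IH T G.
have KK : (#|P| * (2 ^ #|P| * 2 ^ #|P|) <= K * (2 ^ K * 2 ^ K))%N.
  by rewrite !leq_mul // leq_exp2l.
set b := #|_|%:R in h; have [?|blt] := lerP b (eta * #|T|%:R ^+ 2).
  exists P, p; split; last by left.
  by rewrite (leq_trans _ KK) // leq_pmulr // muln_gt0 !expn_gt0.
case: h => [|h]; first by rewrite leNgt blt.
have [Q [q [QP le]]] := regularity_increment G p.
exists Q, q; split; first exact: leq_trans QP KK.
right; apply: le_trans le; rewrite mulrSr lerD // -[leRHS]mulr_natr.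
by rewrite (exprSr _ 4) -mulrA ler_wpM2l ?exprn_ge0 ?ltW.
Qed.

(** A sparse pair of classes carries fewer than [t] times its size in edges, and the sizes of all
    pairs add up to the square of [#|T|]. *)
Lemma card_sparse_le (T P : finType) (G : rel T) (p : T -> P) (t : R) :
    0 <= t ->
  #|[set u | G u.1 u.2 &
      (edges_between G (colour_class p (p u.1)) (colour_class p (p u.2)))%:R
      < t * (#|colour_class p (p u.1)| * #|colour_class p (p u.2)|)%:R]|%:R
    <= t * #|T|%:R ^+ 2.
Proof.
move=> t0; rewrite -natrX -mulnn -card_prod -(sum_card_fibers (pair_colour p)).
rewrite natr_sum mulr_sumr; apply: (card_le_sum_fibers (c := pair_colour p)).
case=> i j; set X := colour_class p i; set Y := colour_class p j.
have -> : #|[set u | pair_colour p u == (i, j)]| = (#|X| * #|Y|)%N.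
  by rewrite -cardsX; apply: eq_card => u; rewrite inE pair_colour_fiber.
have [lt|ge] := ltrP (edges_between G X Y)%:R (t * (#|X| * #|Y|)%:R).
  apply: le_trans (ltW lt); rewrite ler_nat; apply: subset_leq_card.
  apply/subsetP => u; rewrite !inE xpair_eqE => /andP[/andP[Gu _] /andP[-> ->]].
  by rewrite Gu.
rewrite eq_card0 ?mulr_ge0 // => u; rewrite !inE xpair_eqE.
by apply/negP => /andP[/andP[_ lt] /andP[/eqP E1 /eqP E2]];
  move: lt; rewrite E1 E2 ltNge ge.
Qed.

Lemma bipartite_regularity :
  exists K : nat, forall (T : finType) (G : rel T),
    exists (P : finType) (p : T -> P), (#|P| <= K)%N /\
      #|[set u | G u.1 u.2 &
         ~~ lower_regular eta G (colour_class p (p u.1)) (colour_class p (p u.2))]|%:R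
      <= 3 * eta * #|T|%:R ^+ 2.
Proof.
(* The energy is at most [#|T|%:R ^+ 2], so on a nonempty [T] there is no room for [m]
   increments. *)
pose m := Num.bound (eta ^- 5).
have [K HK] := regularity_or_energy m.
exists K => T G; have [P [p [PK h]]] := HK T G; exists P, p; split=> //.
set n := #|T|%:R ^+ 2 : R; set S := [set u | _ & _].
have few : #|[pred u | dense_irregular G p (pair_colour p u)]|%:R <= eta * n.
  case: h => // h; have n0 : 0 <= n by rewrite exprn_ge0.
  have : energy (fun u => (G u.1 u.2)%:R : R) (pair_colour p) <= n.
    apply: le_trans (energy_le _ _) _.
    rewrite /n -natrX -mulnn -card_prod -sum1_card natr_sum; apply: ler_sum => u _.
    by case: (G _ _); rewrite ?expr1n // expr0n.
  move=> /(le_trans h) le_n.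
  have e5 : 0 < eta ^+ 5 by rewrite exprn_gt0.
  have m1 : 1 < eta ^+ 5 * m%:R.
    by rewrite mulrC -ltr_pdivrMr // div1r archi_boundP // invr_ge0 ltW.
  suff T0 : n = 0.
    have : (#|T| = 0)%N by apply/eqP; rewrite -(pnatr_eq0 R) -sqrf_eq0 -/n T0.
    move=> /card0_eq T00; rewrite eq_card0 ?mulr_ge0 ?(ltW eta_gt0) // => u.
    by have := T00 u.1.
  apply/eqP; rewrite eq_le n0 andbT leNgt; apply/negP => ngt.
  move: le_n; apply/negP; rewrite -ltNge -mulr_natr mulrAC.
  by rewrite -[ltLHS]mul1r ltr_pM2r.
have e2 : 0 <= 2 * eta by rewrite mulr_ge0 ?ltW.
have sp := card_sparse_le G p e2; rewrite -/n in sp; set S' := [set u | _ & _] in sp.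
(* An edge in a pair that is not lower regular lies in a dense irregular pair or in a sparse one:
   [eta] plus [2 * eta]. *)
have sub : S \subset [set u | dense_irregular G p (pair_colour p u)] :|: S'.
  apply/subsetP => u; rewrite !inE /dense_irregular /= => /andP[-> ->].
  by rewrite andbT /= leNgt; case: (_ < _).
have : #|S|%:R <= (#|[set u | dense_irregular G p (pair_colour p u)]| + #|S'|)%:R :> R.
  by rewrite ler_nat (leq_trans (subset_leq_card sub)) // cardsU leq_subr.
by rewrite -cardsE in few; rewrite natrD; lra.
Qed.

End Regularity.

(** * Pairs with few common neighbours *)

Definition link (E T : finType) (M : {set E}) (al be : E -> T) (a : T) : {set T} :=
  [set be f | f in [set f in M | al f == a]].

Definition common (E T : finType) (H : {set E}) (al be ga : E -> T) (e : E) :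
    {set T} :=
  [set a | (be e \in link H al be a) && (ga e \in link H al ga a)].

(** Linearity in terms of coordinates: two vertices in different parts determine the edge. *)
Definition jointly_injective (E T : finType) (H : {set E}) (al be : E -> T) : Prop :=
  {in H &, forall e f, al e = al f -> be e = be f -> e = f}.

Lemma jointly_injective_sub (E T : finType) (M H : {set E}) (al be : E -> T) :
  M \subset H -> jointly_injective H al be -> jointly_injective M al be.
Proof. by move=> /subsetP MH inj e f /MH He /MH Hf; exact: inj. Qed.

Lemma card_jointly_injective (E T : finType) (M : {set E}) (S : {set T * T})
    (al be : E -> T) :
    jointly_injective M al be -> (forall e, e \in M -> (al e, be e) \in S) ->
  (#|M| <= #|S|)%N.
Proof.
move=> inj MS; rewrite -(card_in_imset (f := fun e => (al e, be e))).
  by apply/subset_leq_card/subsetP => _ /imsetP[e eM ->]; exact: MS.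
by move=> e f eM fM [? ?]; exact: inj.
Qed.

Lemma card_fiber_jointly_injective (E T : finType) (M : {set E}) (S : {set T})
    (al be : E -> T) (a : T) :
    jointly_injective M al be ->
    (forall e, e \in M -> al e = a -> be e \in S) ->
  (#|[set e in M | al e == a]| <= #|S|)%N.
Proof.
move=> inj MS; rewrite -(card_in_imset (f := be)).
  apply/subset_leq_card/subsetP => _ /imsetP[e + ->].
  by rewrite inE => /andP[eM /eqP ea]; exact: MS.
move=> e f; rewrite !inE => /andP[eM /eqP ea] /andP[fM /eqP fa] ef.
by apply: inj; rewrite ?ea.
Qed.

(** * Edges that end in a class their link hardly meets *)

Section Thin.

Variables (R : realFieldType) (T P : finType) (p : T -> P) (t s : R).
Hypotheses (t_ge0 : 0 <= t) (s_ge0 : 0 <= s).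

(** The relative term [t] makes a non-thin intersection large enough for lower regularity; the
    absolute term [s] makes it large even in a small class. *)
Definition thin (N : {set T}) (y : T) : bool :=
  #|N :&: colour_class p (p y)|%:R < t * #|colour_class p (p y)|%:R + s.

Lemma card_thin (N : {set T}) :
  #|[set y in N | thin N y]|%:R <= t * #|T|%:R + s * #|P|%:R.
Proof.
have -> : t * #|T|%:R + s * #|P|%:R = \sum_i (t * #|colour_class p i|%:R + s).
  by rewrite big_split /= -mulr_sumr -natr_sum sum_card_fibers sumr_const !mulr_natr.
apply: (card_le_sum_fibers (c := p)) => i.
have [lt|ge] := ltrP #|N :&: colour_class p i|%:R
  (t * #|colour_class p i|%:R + s).
  apply: le_trans (ltW lt); rewrite ler_nat; apply: subset_leq_card.
  by apply/subsetP => y; rewrite !inE => /andP[/andP[-> _] ->].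
rewrite eq_card0 ?addr_ge0 ?mulr_ge0 // => y; rewrite !inE /thin.
by apply/negP => /andP[/andP[_ lt] /eqP E]; move: lt; rewrite E ltNge ge.
Qed.

Lemma card_thin_edges (E : finType) (M : {set E}) (al be : E -> T) :
    jointly_injective M al be ->
  #|[set e in M | thin (link M al be (al e)) (be e)]|%:R
    <= #|T|%:R * (t * #|T|%:R + s * #|P|%:R).
Proof.
move=> inj.
have -> : #|T|%:R * (t * #|T|%:R + s * #|P|%:R) =
    \sum_(a : T) (t * #|T|%:R + s * #|P|%:R).
  by rewrite sumr_const mulr_natl.
apply: (card_le_sum_fibers (c := al)) => a.
apply: le_trans (card_thin (link M al be a)); rewrite ler_nat.
apply: card_fiber_jointly_injective.
  by apply: jointly_injective_sub inj; apply/subsetP => e; rewrite inE => /andP[].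
move=> e; rewrite !inE => /andP[eM th] <-; rewrite th andbT.
by apply: imset_f; rewrite inE eM /=.
Qed.

End Thin.

(** Double counting of triangles, by the apex [a] on the left and by an edge of [M] carrying the
    base on the right. *)
Lemma sum_edges_between_links (E T : finType) (M : {set E}) (al be ga : E -> T)
    (G : rel T) :
    (forall y z, G y z -> exists2 h, h \in M & be h = y /\ ga h = z) ->
  (\sum_a edges_between G (link M al be a) (link M al ga a)
    <= \sum_(h in M) #|common M al be ga h|)%N.
Proof.
move=> GM.
have -> : (\sum_(h in M) #|common M al be ga h| =
    \sum_a #|[set h in M | a \in common M al be ga h]|)%N.
  rewrite (eq_bigr (fun h => \sum_(a : T) (a \in common M al be ga h))%N).
    rewrite exchange_big /=; apply: eq_bigr => a _.
    rewrite -sum1_card big_mkcond [RHS]big_mkcond; apply: eq_bigr => h _.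
    by rewrite [in RHS]inE; case: (h \in M); case: (a \in _).
  by move=> h _; rewrite -sum1_card [LHS]big_mkcond; apply: eq_bigr => a _; case: ifP.
apply: leq_sum => a _.
apply: leq_trans (leq_imset_card (fun h => (be h, ga h)) _).
apply/subset_leq_card/subsetP => [[y z]]; rewrite !inE /= => /andP[/andP[yN zN] yz].
have [h hM [hy hz]] := GM _ _ yz; apply/imsetP; exists h; last by rewrite hy hz.
by rewrite !inE hM hy hz yN zN.
Qed.

Lemma common_sub (E T : finType) (M H : {set E}) (al be ga : E -> T) (e : E) :
  M \subset H -> common M al be ga e \subset common H al be ga e.
Proof.
move=> /subsetP MH; apply/subsetP => a; rewrite !inE.
have lk (de : E -> T) x : x \in link M al de a -> x \in link H al de a.
  move=> /imsetP[f]; rewrite inE => /andP[/MH fH fa] ->.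
  by apply: imset_f; rewrite inE fH.
by move=> /andP[/lk -> /lk ->].
Qed.

Definition poor (R : numDomainType) (d : R) (E T : finType) (H : {set E})
    (al be ga : E -> T) : {set E} :=
  [set e in H | #|common H al be ga e|%:R < d].

Lemma card_poor_le (R : archiRealFieldType) (eps : R) : 0 < eps ->
  exists2 delta : R, 0 < delta &
    forall (E T : finType) (H : {set E}) (al be ga : E -> T),
      jointly_injective H al be -> jointly_injective H al ga ->
      jointly_injective H be ga ->
    #|poor (delta * #|T|%:R) H al be ga|%:R <= eps * #|T|%:R ^+ 2.
Proof.
(* The eight parts of [eps] go to [M1] (three), [M2] and [M3] (two each) and [M4] (one). *)
move=> eps0; pose eta := eps / 8; have eta0 : 0 < eta by rewrite divr_gt0.
have [K HK] := bipartite_regularity eta0.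
pose K' : R := K.+1%:R; have K'0 : 0 < K' by rewrite ltr0n.
(* [c * n ^+ 2] is [eta * s ^+ 2], the number of edges that lower regularity yields between two sets
   of size [s]. *)
pose c := eta * (eta / K') ^+ 2.
have c0 : 0 < c by rewrite mulr_gt0 // exprn_gt0 // divr_gt0.
exists (eta * c); first exact: mulr_gt0.
move=> E T H al be ga injab injac injbc.
set M := poor _ _ _ _ _; set n : R := #|T|%:R.
have n0 : 0 <= n by rewrite ler0n.
have MH : M \subset H by apply/subsetP => e; rewrite inE => /andP[].
have Mab := jointly_injective_sub MH injab.
have Mac := jointly_injective_sub MH injac.
have Mbc := jointly_injective_sub MH injbc.
pose G y z := [exists f in M, (be f == y) && (ga f == z)].
have GM y z : G y z -> exists2 h, h \in M & be h = y /\ ga h = z.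
  by move=> /exists_inP[h hM /andP[/eqP hy /eqP hz]]; exists h.
have Gf f : f \in M -> G (be f) (ga f).
  by move=> fM; apply/exists_inP; exists f; rewrite ?eqxx.
have [P [p [PK irr]]] := HK T G.
(* Chosen so that [s], summed over at most [K] classes, costs at most [eta * n]. *)
pose s := eta / K' * n.
have s0 : 0 <= s by rewrite mulr_ge0 // divr_ge0 // ltW.
have sP : s * #|P|%:R <= eta * n.
  rewrite /s mulrAC ler_wpM2r // mulrAC ler_pdivrMr // ler_pM2l // ler_nat.
  exact: leq_trans PK _.
pose N1 := link M al be; pose N2 := link M al ga.
pose M1 := [set e in M | ~~ lower_regular eta G (colour_class p (p (be e)))
                                            (colour_class p (p (ga e)))].
pose M2 := [set e in M | thin p eta s (N1 (al e)) (be e)].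
pose M3 := [set e in M | thin p eta s (N2 (al e)) (ga e)].
pose M4 := M :\: (M1 :|: M2 :|: M3).
have M1le : #|M1|%:R <= 3 * eta * n ^+ 2.
  apply: le_trans irr; rewrite ler_nat.
  apply: (card_jointly_injective (al := be) (be := ga)).
    by apply: jointly_injective_sub Mbc; apply/subsetP => e; rewrite inE => /andP[].
  by move=> e; rewrite in_set => /andP[eM nreg]; rewrite in_set /= nreg Gf.
have M2le : #|M2|%:R <= 2 * eta * n ^+ 2.
  have := card_thin_edges p (ltW eta0) s0 Mab; rewrite -/N1 -/n -/M2 => le.
  apply: (le_trans le); rewrite (_ : 2 * _ * _ = n * (eta * n + eta * n)); last by ring.
  by rewrite ler_wpM2l // lerD2l.
have M3le : #|M3|%:R <= 2 * eta * n ^+ 2.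
  have := card_thin_edges p (ltW eta0) s0 Mac; rewrite -/N2 -/n -/M3 => le.
  apply: (le_trans le); rewrite (_ : 2 * _ * _ = n * (eta * n + eta * n)); last by ring.
  by rewrite ler_wpM2l // lerD2l.
pose good := [set a | c * n ^+ 2 <= (edges_between G (N1 a) (N2 a))%:R].
have goodP e : e \in M4 -> al e \in good.
  rewrite in_setD 2!in_setU !negb_or => /andP[/andP[/andP[e1 e2] e3] eM].
  move: e1 e2 e3.
  rewrite [e \in M1]in_set [e \in M2]in_set [e \in M3]in_set [_ \in good]in_set.
  rewrite eM /= negbK -!leNgt => reg X0 Y0.
  set i := p (be e) in reg X0; set j := p (ga e) in reg Y0.
  set X := N1 _ :&: _ in X0; set Y := N2 _ :&: _ in Y0.
  have Xs : s <= #|X|%:R by apply: le_trans X0; rewrite lerDr mulr_ge0 // ltW.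
  have Ys : s <= #|Y|%:R by apply: le_trans Y0; rewrite lerDr mulr_ge0 // ltW.
  move/forallP: reg => /(_ X) /forallP /(_ Y); rewrite !subsetIr /=.
  rewrite (le_trans _ X0) ?lerDl // (le_trans _ Y0) ?lerDl //= => lXY.
  apply: (@le_trans _ _ (edges_between G X Y)%:R).
    apply: le_trans lXY; rewrite /c -mulrA ler_pM2l // natrM -exprMn -/s expr2.
    exact: ler_pM.
  rewrite ler_nat; apply/subset_leq_card/subsetP => u; rewrite !inE.
  by move=> /andP[/andP[/andP[-> _] /andP[-> _]] ->].
have M4le : #|M4|%:R <= eta * n ^+ 2.
  have le1 : #|M4|%:R <= #|good|%:R * n.
    have -> : #|good|%:R * n = \sum_(a : T) (a \in good)%:R * n.
      by rewrite -mulr_suml -natr_sum -sum1_card [in LHS]big_mkcond.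
    apply: (card_le_sum_fibers (c := al)) => a.
    have [ag|ab] := boolP (a \in good); last first.
      rewrite mul0r eq_card0 // => e; rewrite inE.
      by apply: contraNF ab => /andP[/goodP + /eqP <-].
    rewrite mul1r ler_nat -cardsT; apply: card_fiber_jointly_injective => [|e _ _].
      by apply: jointly_injective_sub Mab; exact: subsetDl.
    exact: in_setT.
  (* Each good vertex is the apex of [c * n ^+ 2] triangles, while the poor edges, at most [n ^+ 2]
     in number, have fewer than [eta * c * n] common neighbours each. *)
  have le2 : #|good|%:R * (c * n ^+ 2) <= n ^+ 2 * (eta * c * n).
    apply: (@le_trans _ _ (\sum_a edges_between G (N1 a) (N2 a))%:R).
      rewrite mulr_natl -sumr_const natr_sum big_mkcond; apply: ler_sum => a _.
      by rewrite inE; case: ifP.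
    apply: (@le_trans _ _ (\sum_(h in M) #|common M al be ga h|)%:R).
      by rewrite ler_nat; exact: sum_edges_between_links.
    apply: (@le_trans _ _ (\sum_(h in M) (eta * c * n))).
      rewrite natr_sum; apply: ler_sum => h hM.
      apply: (@le_trans _ _ #|common H al be ga h|%:R).
        by rewrite ler_nat; exact/subset_leq_card/common_sub.
      by move: hM; rewrite inE => /andP[_ /ltW].
    rewrite sumr_const -[leLHS]mulr_natl ler_wpM2r //.
      by apply: mulr_ge0 => //; exact/ltW/mulr_gt0.
    rewrite /n -natrX ler_nat -mulnn -card_prod -cardsT.
    by apply: card_jointly_injective Mab _ => e _; exact: in_setT.
  have [n0'|n0'] := eqVneq n 0.
    by move: le1; rewrite n0' expr0n /= !mulr0.
  have cn : 0 < c * n by rewrite mulr_gt0 // lt_def n0'.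
  apply: le_trans le1 _; rewrite -(ler_pM2r cn).
  rewrite [leLHS](_ : _ = #|good|%:R * (c * n ^+ 2)); last by ring.
  by apply: le_trans le2 _; rewrite le_eqVlt; apply/orP; left; apply/eqP; ring.
have sub : M \subset M1 :|: M2 :|: M3 :|: M4.
  apply/subsetP => e eM.
  by rewrite in_setU [e \in M4]in_setD eM andbT orbN.
have : #|M|%:R <= (#|M1| + #|M2| + #|M3| + #|M4|)%:R :> R.
  have U (A B : {set E}) : (#|A :|: B| <= #|A| + #|B|)%N by rewrite cardsU leq_subr.
  rewrite ler_nat; apply: leq_trans (subset_leq_card sub) _.
  apply: leq_trans (U _ _) _; rewrite leq_add2r.
  by apply: leq_trans (U _ _) _; rewrite leq_add2r U.
have : eps = 8 * eta by rewrite /eta mulrC divfK // pnatr_eq0.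
by rewrite !natrD => ->; lra.
Qed.

(** * Rainbow cycles *)

(* The cycle has [m.+1] edges [w 0, ..., w m]; its [i]-th vertex is
   [x i (w i)], which lies on [w i.-1] as well. *)
Definition partite_cycle (E T : finType) (H : {set E}) (x : nat -> E -> T)
    (m : nat) (w : nat -> E) : Prop :=
  [/\ forall i, (i <= m)%N -> w i \in H,
      forall i, (i < m)%N -> x i.+1 (w i) = x i.+1 (w i.+1)
    & x 0 (w m) = x 0 (w 0)].

(** The closing edge [w m] is dropped in favour of [f] and [g], which meet in a new vertex [a];
    hence only the edges before [w m] need to be distinct. *)
Lemma partite_cycle_expand (E T : finType) (H : {set E}) (x : nat -> E -> T)
    (m : nat) (w : nat -> E) :
    (0 < m)%N -> jointly_injective H (x m) (x 0) ->
    partite_cycle H x m w -> {in gtn m &, injective w} ->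
    (m.+1 < #|common H (x m.+1) (x m) (x 0) (w m)|)%N ->
  exists w', partite_cycle H x m.+1 w' /\ {in gtn m.+2 &, injective w'}.
Proof.
move=> m0 inj [wH wx w0] winj rich.
(* At most [m.+1] vertices of the next part are forbidden, fewer than the common neighbours
   available. *)
pose B := [set x m.+1 (w (i : 'I_m.+1)) | i : 'I_m.+1].
have /subsetPn[a aC aB] : ~~ (common H (x m.+1) (x m) (x 0) (w m) \subset B).
  apply: contraL rich => /subset_leq_card le; rewrite -leqNgt (leq_trans le) //.
  by rewrite (leq_trans (leq_imset_card _ _)) // card_ord.
have aNw i : (i <= m)%N -> a <> x m.+1 (w i).
  rewrite -ltnS => im ai; move/negP: aB; apply.
  by rewrite ai; apply: (imset_f _ (x := Ordinal im)).
move: aC; rewrite inE => /andP[/imsetP[f + fx] /imsetP[g + gx]].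
rewrite !inE => /andP[fH /eqP fa] /andP[gH /eqP ga].
pose w' i := if (i < m)%N then w i else if i == m then f else g.
have w'lt i : (i < m)%N -> w' i = w i by rewrite /w' => ->.
have w'm : w' m = f by rewrite /w' ltnn eqxx.
have w'S : w' m.+1 = g by rewrite /w' ltnNge leqnSn gtn_eqF.
(* If [f] and [g] agreed, this edge would share two coordinates with [w m], hence be [w m], whose
   vertex in the next part is not [a]. *)
have fNg : f <> g.
  move=> fg; apply: (aNw m) => //; rewrite -fa; congr (x _ _).
  by apply: inj; rewrite ?wH // ?fx // gx fg.
exists w'; split.
  split=> [i|i|].
  - rewrite leq_eqVlt ltnS leq_eqVlt => /or3P[/eqP->|/eqP->|im].
    + by rewrite w'S.
    + by rewrite w'm.
    + by rewrite w'lt // wH // ltnW.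
  - rewrite ltnS leq_eqVlt => /orP[/eqP->|im]; first by rewrite w'm w'S fa ga.
    rewrite w'lt // wx //; move: im; rewrite leq_eqVlt => /orP[/eqP->|im].
      by rewrite w'm fx.
    by rewrite w'lt.
  - by rewrite w'S -gx w'lt // w0.
have wNf i : (i < m)%N -> w i <> f.
  by move=> im wf; apply: (aNw i (ltnW im)); rewrite wf fa.
have wNg i : (i < m)%N -> w i <> g.
  by move=> im wg; apply: (aNw i (ltnW im)); rewrite wg ga.
have cs i : i \in gtn m.+2 -> [\/ (i < m)%N, i = m | i = m.+1].
  rewrite !inE ltnS leq_eqVlt ltnS leq_eqVlt => /or3P[/eqP|/eqP|];
  by [constructor 3|constructor 2|constructor 1].
move=> i j /cs ci /cs cj; case: ci => [im|->|->]; case: cj => [jm|->|->];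
  rewrite ?w'm ?w'S ?w'lt //.
- exact: winj.
- by move/wNf: im.
- by move/wNg: im.
- by move/esym; move/wNf: jm.
- by move/esym; move/wNg: jm.
- by move/esym.
Qed.

Section Cycles.

Variable R : archiRealFieldType.

(* Only [w 0, ..., w b.-1] are required to be distinct: [b = m] allows the
   degenerate cycle [w 0 = w 1]. *)
Definition dense_has_cycle (b m : nat) : Prop :=
  forall eps : R, 0 < eps -> exists n0 : nat,
  forall (E T : finType) (H : {set E}) (x : nat -> E -> T),
    (n0 <= #|T|)%N ->
    (forall i j, (i <= m)%N -> (j <= m)%N -> i <> j ->
       jointly_injective H (x i) (x j)) ->
    eps * #|T|%:R ^+ 2 <= #|H|%:R ->
  exists w, partite_cycle H x m w /\ {in gtn b &, injective w}.

Lemma dense_has_cycle1 : dense_has_cycle 1 1.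
Proof.
(* A nonempty [T] makes the lower bound on [#|H|] positive. *)
move=> eps eps0; exists 1%N => E T H x T0 _ le.
have : (0 < #|H|)%N.
  rewrite -(ltr_nat R); apply: lt_le_trans le.
  by rewrite mulr_gt0 // exprn_gt0 // ltr0n.
case/card_gt0P => e eH; exists (fun=> e); split; first by split.
by move=> i j; rewrite !inE !ltnS !leqn0 => /eqP-> /eqP->.
Qed.

(* Discarding the poor edges costs less than half of them, and every closing
   edge of a cycle made of the others can be replaced by a path of length two. *)
Lemma dense_has_cycleS (m : nat) :
  (0 < m)%N -> dense_has_cycle m m -> dense_has_cycle m.+2 m.+1.
Proof.
move=> m0 IH eps eps0; have e2 : 0 < eps / 2 by rewrite divr_gt0.
have [delta d0 poorP] := card_poor_le e2.
have [n1 n1P] := IH _ e2.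
(* The second bound ensures [delta * #|T|%:R > m.+1%:R], so an edge that is not poor has more than
   [m.+1] common neighbours. *)
exists (maxn n1 (Num.bound (m.+1%:R / delta))) => E T H x.
rewrite geq_max => /andP[Tn1 Tb] inj le.
set P := poor (delta * #|T|%:R) H (x m.+1) (x m) (x 0).
have Ple : #|P|%:R <= eps / 2 * #|T|%:R ^+ 2.
  by apply: poorP; apply: inj => //; lia.
have [//|i j im jm ij||w [wc winj]] := n1P E T (H :\: P) x.
- by apply: jointly_injective_sub (inj i j _ _ ij); rewrite ?subsetDl ?leqW.
- have : #|H|%:R = #|P|%:R + #|H :\: P|%:R :> R.
    rewrite -natrD -(cardsID P H); congr (_ + _)%:R; apply: eq_card => e.
    by rewrite !inE; case: (e \in H).
  lra.
have wHP i : (i <= m)%N -> w i \in H :\: P by case: wc => wH _ _; exact: wH.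
apply: (partite_cycle_expand m0 _ _ winj).
- by apply: inj => //; lia.
- case: wc => _ ? ?; split=> // i /wHP.
  by rewrite inE => /andP[].
have := wHP m (leqnn m); rewrite 2!inE => /andP[+ wmH]; rewrite wmH -leNgt.
rewrite -(ltr_nat R); apply: lt_le_trans.
rewrite mulrC -ltr_pdivrMr //.
apply: (@lt_le_trans _ _ (Num.bound (m.+1%:R / delta))%:R).
  by rewrite archi_boundP // divr_ge0 // ltW.
by rewrite ler_nat.
Qed.

(** The induction runs on [dense_has_cycle m m]: genuine cycles satisfy it by forgetting that the
    last edge is distinct from the others, and the degenerate one satisfies it for [m = 1]. *)
Lemma dense_has_cycle_all (m : nat) : (0 < m)%N -> dense_has_cycle m.+2 m.+1.
Proof.
move=> m0; apply: dense_has_cycleS => //; elim: m m0 => // m IH _.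
case: (posnP m) => [->|m0]; first exact: dense_has_cycle1.
move=> eps eps0; have [n0 n0P] := dense_has_cycleS m0 (IH m0) eps0.
exists n0 => E T H x T0 inj le; have [w [wc winj]] := n0P E T H x T0 inj le.
by exists w; split=> // i j im jm; apply: winj; rewrite inE ltnW.
Qed.

End Cycles.

(** * Coordinates of the edges of a partite hypergraph *)

Section Coordinates.

Variables (r : nat) (T : finType) (V : 'I_r.+1 -> {set T}) (H : {set {set T}}).
Hypotheses (VH : vertex_parts V H) (linH : linear_hypergraph H).
Variable t0 : T.

(** The vertex of [e] in part [i]. The default [t0] is never reached on edges of [H], and [inord] is
    faithful for [i <= r]. *)
Definition coordinate (i : nat) (e : {set T}) : T :=
  odflt t0 [pick v in e :&: V (inord i)].

Lemma coordinateP (i : nat) (e : {set T}) :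
  e \in H -> coordinate i e \in e :&: V (inord i).
Proof.
move=> eH; rewrite /coordinate; case: pickP => //= none.
by case: VH => _ _ /(_ e (inord i) eH) => /eqP; rewrite eq_card0.
Qed.

Lemma parts_disjoint (i j : nat) (v : T) : (i <= r)%N -> (j <= r)%N ->
  v \in V (inord i) -> v \in V (inord j) -> i = j.
Proof.
move=> ir jr vi vj; have [//|ij] := eqVneq i j.
case: VH => _ dis _.
have /dis : inord i != inord j :> 'I_r.+1.
  by apply: contra ij => /eqP/(congr1 val); rewrite /= !inordK // => ->.
by move=> /disjointFr /(_ vi); rewrite vj.
Qed.

(** Two distinct edges agreeing in two coordinates would share two vertices, distinct because the
    parts are disjoint. *)
Lemma coordinate_jointly_injective (i j : nat) :
  (i <= r)%N -> (j <= r)%N -> i <> j ->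
  jointly_injective H (coordinate i) (coordinate j).
Proof.
move=> ir jr ij e f eH fH eqi eqj; have [//|ef] := eqVneq e f.
have := linH eH fH ef.
have /setIP[ei iV] := coordinateP i eH; have /setIP[ej jV] := coordinateP j eH.
have /setIP[fi _] := coordinateP i fH; have /setIP[fj _] := coordinateP j fH.
move=> /card_le1P /(_ (coordinate i e)).
rewrite inE ei eqi fi => /(_ isT) /(_ (coordinate j e)).
rewrite !inE ej eqj fj -eqi -eqj => /esym /eqP E.
by case: ij; apply: (parts_disjoint ir jr iV); rewrite -E.
Qed.

Lemma rainbow_cycle_of_partite (m : nat) (w : nat -> {set T}) :
  (m <= r)%N -> partite_cycle H coordinate m w -> {in gtn m.+1 &, injective w} ->
  has_rainbow_cycle m.+1 V H.
Proof.
move=> mr [wH wx w0] winj.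
have vV (i : 'I_m.+1) : coordinate i (w i) \in w i :&: V (inord i).
  by apply/coordinateP/wH; rewrite -ltnS.
have ir (i : 'I_m.+1) : (i <= r)%N by apply: leq_trans mr; rewrite -ltnS.
exists (fun i : 'I_m.+1 => coordinate i (w i)), (fun i => w i); split.
- move=> i j vij; apply: val_inj => /=.
  apply: (@parts_disjoint _ _ (coordinate i (w i))) => //.
    by have /setIP[] := vV i.
  by rewrite vij; have /setIP[] := vV j.
- split=> [i j|i]; first by move/winj => /(_ (ltn_ord i) (ltn_ord j)) /val_inj.
  by apply: wH; rewrite -ltnS.
- move=> i; split; first by have /setIP[] := vV i.
  have wi : w i \in H by apply: wH; rewrite -ltnS.
  have [im|] := ltnP i m.
    (* Before the last index the cyclic successor is [i.+1]; at [i = m] it wraps to [0] and the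
       closing condition applies. *)
    rewrite /= modn_small ?ltnS // -wx //.
    by have /setIP[] := coordinateP i.+1 wi.
  move=> mi; have im : i = m :> nat by apply/eqP; rewrite eqn_leq mi -ltnS ltn_ord.
  rewrite /= im modnn -w0 -im.
  by have /setIP[] := coordinateP 0 wi.
- exists (fun i => inord i) => [i j|i]; last by have /setIP[] := vV i.
  by move=> /(congr1 val); rewrite /= !inordK ?ltnS // => /val_inj.
Qed.

End Coordinates.

Theorem theorem3p4 (R : realType) (r : nat) (hr : (0 < r)%N)
    (eps : R) (heps : 0 < eps) :
  exists n0 : nat, forall n : nat, (n0 <= n)%N ->
    forall (T : finType) (V : 'I_r -> {set T}) (H : {set {set T}}),
      #|T| = n ->
      uniform r H -> vertex_parts V H -> linear_hypergraph H ->
      eps * n%:R ^+ 2 <= #|H|%:R ->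
      forall k : nat, (3 <= k <= r)%N -> has_rainbow_cycle k V H.
Proof.
(* One [n0] must serve all lengths [k = m.+2]; it is a maximum over the finitely many [m], built by
   induction on [r.-1]. *)
suff [n0 n0P] : exists n0 : nat, forall m, (0 < m < r.-1)%N ->
    forall (E T : finType) (H : {set E}) (x : nat -> E -> T), (n0 <= #|T|)%N ->
    (forall i j, (i <= m.+1)%N -> (j <= m.+1)%N -> i <> j ->
       jointly_injective H (x i) (x j)) ->
    eps * #|T|%:R ^+ 2 <= #|H|%:R ->
  exists w, partite_cycle H x m.+1 w /\ {in gtn m.+2 &, injective w}.
  (* The successor makes [T] nonempty, which supplies the default vertex [t0]. *)
  exists n0.+1 => n n0n T V H Tn _ VH linH le [|[|k]] // kr.
  case: r hr V VH n0P kr => // r' _ V VH n0P kr.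
  have /card_gt0P[t0 _] : (0 < #|T|)%N by rewrite Tn (leq_trans _ n0n).
  have [||i j ik jk ij||w [wc winj]] := n0P k _ _ _ H (coordinate V t0).
  - lia.
  - by rewrite Tn ltnW.
  - by apply: coordinate_jointly_injective => //; lia.
  - by rewrite Tn.
  by apply: (rainbow_cycle_of_partite VH _ wc winj); lia.
elim: (r.-1) => [|s [n1 n1P]]; first by exists 0%N => m; rewrite ltn0 andbF.
case: (posnP s) => [->|s0]; first by exists 0%N => -[|m]; rewrite ?andbF.
have [n2 n2P] := dense_has_cycle_all s0 heps.
exists (maxn n1 n2) => m /andP[m0 ms] E T H x; rewrite geq_max => /andP[T1 T2].
have [-> |ns] := eqVneq m s; first exact: n2P.
by apply: n1P; rewrite // m0 /= ltn_neqAle ns -ltnS.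
Qed.
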